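(* For every prime number $p$, there exists a sequence of matrices $M^{(t)}$, $t = 1,2,3,\dots$, with entries in the finite field $\mathbb{F}_p$, where $M^{(t)}$ is an $n^{(t)} \times n^{(t)}$ fooling-set matrix, such that $n^{(t)} \to \infty$ as $t\to\infty$ and \[ \frac{n^{(t)}}{(\operatorname{rk}_{\mathbb{F}_p} M^{(t)})^2} \longrightarrow 1 \quad (t\to\infty). \]
   Context: An $n\times n$ matrix $M$ over a field is called a fooling-set matrix of size $n$ if all its diagonal entries $M_{k,k}$ are nonzero and $M_{k,\ell}M_{\ell,k}=0$ for all $k\neq \ell$. $\mathbb{F}_p$ denotes the field with $p$ elements and $\operatorname{rk}_{\mathbb{F}_p}$ the rank over $\mathbb{F}_p$. *)

(* Defs.v *)
From mathcomp Require Import all_boot all_algebra.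

Set Implicit Arguments.
Unset Strict Implicit.
Unset Printing Implicit Defensive.

Import GRing.Theory.
Local Open Scope ring_scope.

Definition fooling_set_matrix (F : fieldType) (n : nat) (M : 'M[F]_n) : Prop :=
  (forall k : 'I_n, M k k != 0) /\
  (forall k l : 'I_n, k != l -> M k l * M l k = 0).

(* Main.v *)
Require Import Defs.
From mathcomp Require Import all_boot all_order all_algebra.
From mathcomp Require Import all_classical all_reals all_analysis.
From mathcomp Require Import zify ring lra.
Import numFieldNormedType.Exports.
Import Order.TTheory GRing.Theory Num.Theory.

Set Implicit Arguments.
Unset Strict Implicit.
Unset Printing Implicit Defensive.

Local Open Scope classical_set_scope.
Local Open Scope ring_scope.

(** Let q be a power of p, n = q^2 + q + 1 and P = 1 + X^q + X^(q+1).  Raising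
    X^q (1 + X) = -1 to the power q shows that X^n = 1 modulo P, so the linear
    recurrence with characteristic polynomial P has period n.  The circulant
    matrix built from the cofactor of P in 1 - X^n therefore has rank
    deg P = q + 1.  It is a fooling-set matrix because the cofactor is supported
    on q^2 and on the numbers q j + i with i <= j < q. *)

Definition cofactor_poly (F : fieldType) (q : nat) : {poly F} :=
  \sum_(j < q) (- ('X^q * (1 + 'X))) ^+ j - 'X^(q ^ 2).

(** The shift by [q ^ 2] puts the coefficient of the separate monomial [- 'X^(q ^ 2)] on the
    diagonal. The added [n] keeps the truncated subtraction exact, as [l < n]. *)
Definition cofactor_circulant (F : fieldType) (q : nat) : 'M[F]_(q ^ 2 + q + 1) :=
  let n := (q ^ 2 + q + 1)%N in
  \matrix_(k, l) (cofactor_poly F q)`_((q ^ 2 + n + k - l) %% n).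

(** With Y = -X^q (1 + X), the left factor is 1 - Y and the geometric sum telescopes to 1 - Y^q. By
    Frobenius this is 1 + X^(q^2) + X^(q^2 + q); subtracting X^(q^2) (1 - Y) leaves the right-hand
    side. *)
Lemma cofactor_polyP (F : fieldType) (p e : nat) (q := (p ^ e)%N) :
  p \in [pchar F] ->
  (1 + 'X^q + 'X^(q.+1)) * cofactor_poly F q = 1 - 'X^(q ^ 2 + q + 1).
Proof.
move=> pF; have pP : p \in [pchar {poly F}] by rewrite pchar_poly.
have qX (x : {poly F}) : (1 + x) ^+ q = 1 + x ^+ q.
  by rewrite (@exprDn_pchar _ _ _ q) ?expr1n // (eq_pnat _ (pcharf_eq pP)) pnatX
             pnat_id ?(pcharf_prime pF).
(* Additivity of Frobenius on x + (-x) gives the sign for even and odd [q] alike. *)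
have Nq (x : {poly F}) : (- x) ^+ q = - x ^+ q.
  by apply: (addrI (x ^+ q)); rewrite -exprDn_pchar ?subrr ?expr0n;
    rewrite ?(eq_pnat _ (pcharf_eq pP)) ?pnatX ?pnat_id ?(pcharf_prime pF) //;
    rewrite /q expn_eq0; case: (p) (pcharf_prime pF).
rewrite /cofactor_poly; set Y := - _.
have -> : 1 + 'X^q + 'X^(q.+1) = 1 - Y :> {poly F} by rewrite /Y exprSr; ring.
rewrite mulrBr -[1 - Y]opprB mulNr -subrX1 opprB Nq exprMn qX /Y -exprM mulnn.
rewrite !exprD expr1; ring.
Qed.

Lemma coef_cofactor_term (F : fieldType) (q j m : nat) :
  ((- ('X^q * (1 + 'X)) : {poly F}) ^+ j)`_m != 0 -> (q * j <= m <= q * j + j)%N.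
Proof.
rewrite exprNn -polyC1 -polyCN -polyC_exp coefCM mulf_eq0 negb_or => /andP[_].
rewrite exprMn -exprM coefXnM; case: ltnP => [|qjm]; first by rewrite eqxx.
apply: contraNT => H; rewrite nth_default // addrC.
rewrite -[1%:P]opprK -polyCN size_exp_XsubC; lia.
Qed.

(** The terms with j < q have degree at most j (q + 1) < q^2, so none of them meets the monomial. *)
Lemma coef_cofactor_sq (F : fieldType) (q : nat) :
  (cofactor_poly F q)`_(q ^ 2) = -1.
Proof.
rewrite coefB coefXn eqxx coef_sum big1 ?sub0r // => j _.
apply/eqP/negPn/negP => /coef_cofactor_term; have := ltn_ord j; nia.
Qed.

Lemma cofactor_supp (F : fieldType) (q m : nat) :
  (cofactor_poly F q)`_m != 0 ->
  m = (q ^ 2)%N \/ exists i j : nat, [/\ m = (q * j + i)%N, i <= j & j < q]%N.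
Proof.
move=> nz; case: (eqVneq m (q ^ 2)%N) => [->|ne]; [by left|right].
move: nz; rewrite coefB coefXn (negPf ne) subr0 coef_sum.
case: (pickP (fun j : 'I_q => ((- ('X^q * (1 + 'X)) : {poly F}) ^+ j)`_m != 0)).
  move=> j /coef_cofactor_term jm _; exists (m - q * j)%N, j.
  by split; [lia|lia|exact: ltn_ord].
by move=> z; rewrite big1 ?eqxx // => j _; apply/eqP/negPn; rewrite (z j).
Qed.

Lemma cofactor_supp_le (F : fieldType) (q m : nat) :
  (q ^ 2 < m)%N -> (cofactor_poly F q)`_m = 0.
Proof.
move=> lt; apply/eqP/negPn/negP => /cofactor_supp[|[i [j []]]]; nia.
Qed.

(** Modulo [n], a + b is 2Q. As a and b are at most Q, only 2Q and 2Q - n = Q - q - 1 are possible,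
    and the former forces a = b = Q, hence k = l. *)
Lemma opposite_cyclic_indices (Q q n k l a b u v : nat) :
  n = (Q + q + 1)%N -> (k < n)%N -> (l < n)%N -> k <> l ->
  (Q + n + k - l = u * n + a)%N -> (Q + n + l - k = v * n + b)%N ->
  (a <= Q)%N -> (b <= Q)%N -> (a + b + q + 1 = Q)%N.
Proof.
move=> nE kn ln kl aE bE aQ bQ.
(* Bounded quotients allow a case split after which the equations are linear. *)
have lt3 w x y z : (x < n)%N -> (Q + n + x - y = w * n + z)%N -> (w < 3)%N.
  move=> xn wE; rewrite ltnNge; apply/negP => w3.
  have := leq_mul w3 (leqnn n); lia.
have := lt3 _ _ _ _ kn aE; have := lt3 _ _ _ _ ln bE.
by case: u aE => [|[|[|//]]] aE; case: v bE => [|[|[|//]]] bE _ _; lia.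
Qed.

(** Equality would make i + i' + 1 a positive multiple of q, yet also bound it by j + j' + 1 = q -
    d, where d >= 1 is the quotient. *)
Lemma no_opposite_triangle_points (q i j i' j' : nat) :
  (i <= j)%N -> (i' <= j')%N -> (j < q)%N -> (j' < q)%N ->
  (q * j + i + (q * j' + i') + q + 1)%N <> (q ^ 2)%N.
Proof.
move=> ij ij' jq jq' E.
have qd : (q * (j + j' + 1) + (i + i' + 1) = q * q)%N by rewrite mulnn -E; lia.
have sq : (j + j' + 1 <= q)%N.
  rewrite leqNgt; apply/negP => lt; have := leq_mul (leqnn q) lt; lia.
have [d dE] : exists d, q = (j + j' + 1 + d)%N by exists (q - (j + j' + 1))%N; lia.
have : (q * d = i + i' + 1)%N by rewrite {2}dE mulnDr in qd; lia.
by case: d dE => [|[|d]] dE; rewrite ?muln0 ?muln1 ?mulnS; lia.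
Qed.

Lemma cofactor_circulant_fooling (F : fieldType) (q : nat) :
  fooling_set_matrix (cofactor_circulant F q).
Proof.
split=> [k|k l kl]; rewrite !mxE.
  rewrite addnK modnDr modn_small ?coef_cofactor_sq ?oppr_eq0 ?oner_eq0 //; lia.
apply/eqP/negPn/negP; rewrite mulf_eq0 negb_or.
move=> /andP[/cofactor_supp a_supp /cofactor_supp b_supp].
have kl' : (k : nat) <> l by move/ord_inj/eqP; rewrite (negPf kl).
have le_sq m : m = (q ^ 2)%N \/
    (exists i j : nat, [/\ m = (q * j + i)%N, i <= j & j < q]%N) -> (m <= q ^ 2)%N.
  case=> [->//|[i [j [-> ij jq]]]].
  by rewrite -mulnn; have := leq_mul (leqnn q) jq; rewrite mulnS; lia.
(* The two indices and q + 1 add up to q^2, so neither index is q^2 and both are of the form q j +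
   i. *)
have := opposite_cyclic_indices (erefl _) (ltn_ord k) (ltn_ord l) kl'
  (divn_eq _ _) (divn_eq _ _) (le_sq _ a_supp) (le_sq _ b_supp).
case: a_supp => [->|[i [j [-> ij jq]]]]; first lia.
case: b_supp => [->|[i' [j' [-> ij' jq']]]]; first lia.
exact: no_opposite_triangle_points.
Qed.

Lemma coef_cofactor_rec (F : fieldType) (p e m : nat) (q := (p ^ e)%N) :
  p \in [pchar F] ->
  (cofactor_poly F q)`_m
    + (if (m < q)%N then 0 else (cofactor_poly F q)`_(m - q))
    + (if (m < q.+1)%N then 0 else (cofactor_poly F q)`_(m - q.+1))
  = (m == 0)%N%:R - (m == q ^ 2 + q + 1)%N%:R.
Proof.
move=> pF; have /(congr1 (fun f : {poly F} => f`_m)) := cofactor_polyP e pF.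
rewrite -/q; move: (cofactor_poly F q) => G.
by rewrite !mulrDl mul1r !coefD !coefXnM coefN coefXn coef1.
Qed.

Lemma coef_cofactor0 (F : fieldType) (p e : nat) :
  p \in [pchar F] -> (cofactor_poly F (p ^ e))`_0 = 1.
Proof.
move=> pF; have := @coef_cofactor_rec _ _ e 0 pF.
have q0 : (0 < p ^ e)%N by rewrite expn_gt0 prime_gt0 ?(pcharf_prime pF).
by rewrite q0 /= addn1 !addr0 subr0.
Qed.

(** The product 1 - X^n vanishes modulo X^n - 1, so the recurrence survives cyclic reading of the
    coefficients. The cases follow which indices wrap around. *)
Lemma cofactor_cyclic_rec (F : fieldType) (p e m : nat) (q := (p ^ e)%N)
    (n := (q ^ 2 + q + 1)%N) (g := fun i => (cofactor_poly F q)`_(i %% n)) :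
  p \in [pchar F] -> g (m + q.+1)%N = - g m.+1 - g m.
Proof.
move=> pF; suff: g (m + q.+1)%N + g m.+1 + g m = 0.
  by move/eqP; rewrite -addrA addr_eq0 opprD => /eqP.
rewrite /g -(modnDml m q.+1) -[m.+1]addn1 -(modnDml m 1) addn1.
have q0 : (0 < q)%N by rewrite expn_gt0 prime_gt0 ?(pcharf_prime pF).
have : (m %% n < n)%N by rewrite ltn_mod /n addn1.
move: (m %% n)%N => {m} r rn; have nE : n = (q ^ 2 + q + 1)%N by [].
have rec := fun i => @coef_cofactor_rec _ _ e i pF.
(* Below q^2 no index wraps; from q^2 on, r + q + 1 wraps to i = r - q^2. *)
have [rq|rq] := ltnP r (q ^ 2).
  rewrite !modn_small; [|lia..].
  have := rec (r + q.+1)%N; rewrite -/q !ifF; [|lia..].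
  have -> : (r + q.+1 - q = r.+1)%N by lia.
  rewrite addnK => ->.
  have [-> ->] : (r + q.+1 == 0)%N = false /\
    (r + q.+1 == q ^ 2 + q + 1)%N = false by lia.
  by rewrite subrr.
have [i rE] : exists i, r = (q ^ 2 + i)%N by exists (r - q ^ 2)%N; lia.
have -> : ((r + q.+1) %% n = i)%N.
  have -> : (r + q.+1 = i + n)%N by lia.
  rewrite modnDr modn_small; lia.
have [iq|iq] := ltnP i q.
  rewrite modn_small; last lia.
  rewrite (cofactor_supp_le _ (m := r.+1)); last lia.
  (* At i = 0 the constant coefficient 1 cancels the coefficient -1 at q^2. *)
  rewrite addr0; case: (posnP i) => [i0|i0].
    by rewrite rE i0 addn0 coef_cofactor_sq coef_cofactor0 // subrr.
  rewrite (cofactor_supp_le _ (m := r)) ?addr0; last lia.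
  have := rec i; rewrite -/q !ifT ?addr0 => [->||]; [|lia..].
  have [-> ->] : (i == 0)%N = false /\ (i == q ^ 2 + q + 1)%N = false by lia.
  by rewrite subrr.
(* Here r + 1 = n wraps to 0 as well. *)
have iE : i = q by lia.
have -> : r.+1 = n by lia.
rewrite modnn (cofactor_supp_le _ (m := r)); last lia.
rewrite addr0 iE; have := rec q; rewrite -/q ltnn subnn ltnSn addr0 => ->.
have [-> ->] : (q == 0)%N = false /\ (q == q ^ 2 + q + 1)%N = false by lia.
by rewrite subrr.
Qed.

(** By the cyclic recurrence every row from index q + 1 on is a combination of two earlier rows,
    which bounds the rank above; a triangular minor of size q + 1 bounds it below. *)
Lemma rank_cofactor_circulant (F : fieldType) (p e : nat) :
  p \in [pchar F] -> \rank (cofactor_circulant F (p ^ e)) = (p ^ e).+1.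
Proof.
move=> pF; set q := (p ^ e)%N; set n := (q ^ 2 + q + 1)%N.
set M := cofactor_circulant F q.
have qn : (q.+1 <= n)%N by rewrite /n; nia.
pose top : 'M[F]_(q.+1, n) := rowsub (widen_ord qn) M.
have topP (k : nat) (kn : (k < n)%N) : (row (Ordinal kn) M <= top)%MS.
  elim/ltn_ind: k kn => k IH kn; have [kq|kq] := ltnP k q.+1.
    have -> : row (Ordinal kn) M = row (Ordinal kq) top.
      by apply/rowP => j; rewrite !mxE.
    exact: row_sub.
  have k1n : (k - q < n)%N by lia.
  have k2n : (k - q.+1 < n)%N by lia.
  have -> : row (Ordinal kn) M =
      - row (Ordinal k1n) M - row (Ordinal k2n) M.
    apply/rowP => -[l ln]; rewrite !mxE /= -/n; rewrite -/n in ln.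
    have := @cofactor_cyclic_rec F p e (q ^ 2 + n + (k - q.+1) - l) pF.
    rewrite -/q -/n => E.
    have -> : (q ^ 2 + n + k - l = q ^ 2 + n + (k - q.+1) - l + q.+1)%N by lia.
    rewrite E; congr (- _`_(_ %% _) - _).
    by lia.
  have q0 : (0 < q)%N by rewrite expn_gt0 prime_gt0 ?(pcharf_prime pF).
  by apply: addmx_sub; rewrite eqmx_opp IH //; lia.
apply/eqP; rewrite eqn_leq; apply/andP; split.
  have : (M <= top)%MS by apply/row_subP => -[k kn]; apply: topP.
  by move/mxrankS => /leq_trans -> //; apply: rank_leq_row.
have cP (j : 'I_q.+1) : (q ^ 2 + j < n)%N by have := ltn_ord j; rewrite /n; lia.
(* For k < j the entry has index n + k - j > q^2, beyond the degree; on the diagonal the index wraps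
   to 0, where the coefficient is 1. *)
pose T : 'M[F]_q.+1 := mxsub (widen_ord qn) (fun j => Ordinal (cP j)) M.
have Ttrig : is_trig_mx T.
  apply/is_trig_mxP => k j kj; rewrite !mxE /= -/n.
  have jq := ltn_ord j.
  rewrite modn_small; last lia.
  by rewrite cofactor_supp_le // /n; lia.
have Tunit : T \in unitmx.
  rewrite unitmxE det_trig // big1 ?unitr1 // => k _; rewrite !mxE /= -/n.
  have -> : (q ^ 2 + n + k - (q ^ 2 + k) = n)%N by lia.
  by rewrite modnn coef_cofactor0.
have <- := mxrank_unit Tunit.
have -> : T = colsub (fun j => Ordinal (cP j)) top.
  by apply/matrixP => k j; rewrite !mxE.
have /mxrankS/(leq_trans _) -> // : (top <= M)%MS.
  by apply/row_subP => k; rewrite row_rowsub row_sub.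
by rewrite -{1}(mulmx1 top) -mulmx_colsub mxrankM_maxl.
Qed.

(** Since q^2 + q = (q + 1)^2 - (q + 1), the ratio lies between 1 - 1/(q + 1) >= 1 - 1/(t + 1) and
    1. *)
Lemma cvg_square_ratio (R : realType) (q : nat -> nat) :
  (forall t, (t <= q t)%N) ->
  ((q t ^ 2 + q t + 1)%:R / (q t).+1%:R ^+ 2 : R) @[t --> \oo] --> (1 : R).
Proof.
move=> tq.
have lim1 : 1 - harmonic t @[t --> \oo] --> (1 : R).
  rewrite -[X in _ --> X](subr0 (1 : R)).
  exact: cvgB (cvg_cst _) cvg_harmonic.
apply: (squeeze_cvgr _ lim1 (cvg_cst (1 : R))).
apply: nearW => t; rewrite /harmonic /=.
have tq1 : t.+1%:R <= (q t).+1%:R :> R by rewrite ler_nat ltnS.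
have t0 : 0 < t.+1%:R :> R by rewrite ltr0n.
have q0 := lt_le_trans t0 tq1.
have le1 : (q t).+1%:R^-1 <= t.+1%:R^-1 :> R by rewrite lef_pV2 ?posrE.
have qge : 0 <= (q t)%:R :> R by rewrite ler0n.
rewrite ler_pdivrMr ?exprn_gt0 // mul1r; apply/andP; split; last first.
  by rewrite -natrX ler_nat; nia.
apply: (@le_trans _ _ (1 - (q t).+1%:R^-1)); first by rewrite lerB.
rewrite ler_pdivlMr ?exprn_gt0 // expr2 mulrA mulrBl mulVf ?gt_eqF // mul1r.
rewrite !natrD natrX -natr1; nra.
Qed.

Theorem theorem3p1 (R : realType) (p : nat) (hp : prime p) :
  exists (n : nat -> nat) (M : forall t : nat, 'M['F_p]_(n t)),
    [/\ forall t : nat, fooling_set_matrix (M t),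
        n t @[t --> \oo] --> \oo
      & ((n t)%:R / (\rank (M t))%:R ^+ 2 : R) @[t --> \oo] --> (1 : R)].
Proof.
have tq t : (t <= p ^ t)%N by apply/ltnW/ltn_expl/prime_gt1.
exists (fun t => (p ^ t) ^ 2 + p ^ t + 1)%N, (fun t => cofactor_circulant 'F_p (p ^ t)).
split=> [t||]; first exact: cofactor_circulant_fooling.
- apply/cvgnyPge => A; near=> t.
  have At : (A <= t)%N by near: t; exact: nbhs_infty_ge.
  by have := tq t; lia.
- under eq_fun do rewrite (rank_cofactor_circulant _ (pchar_Fp hp)).
  exact: cvg_square_ratio.
Unshelve. all: by end_near.
Qed.
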